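(* The pair $(\{P_k(x;y)\}_{k=0}^\infty,\{(2k)!\}_{k=0}^\infty)$ is a palindromic pair with degree $d(n)=\frac n2$. Similarly, the pair $(\{Q_k(x;y)\}_{k=0}^\infty,\{(2k+1)!\}_{k=0}^\infty)$ is a palindromic pair with degree $d(n)=\frac{n-2}{2}$.
   Context: Palindromic pairs. Let $\{p_k(x;y)\}_{k=0}^\infty$ be a sequence of polynomials in two variables with $p_0(x;y)=1$, $\{a_k\}_{k=0}^\infty$ a sequence of non-zero numbers, and $d\colon\mathbb{Z}_{\ge0}\to\mathbb{R}$ a map. For $n\in\mathbb{Z}_{\ge0}$ put $\mathscr{S}_k(p;n)=\{s\in\mathbb{C}:p_k(s;n)=0\}$. The pair $(\{p_k\},\{a_k\})$ is a palindromic pair with degree $d(n)$ if, for each $n\in\mathbb{Z}_{\ge 0}$ with $d(n)\in\mathbb{Z}_{\ge0}$, there exists a map $\theta_{(p;n)}\colon\mathscr{S}_{d(n)+1}(p;n)\to\{\pm1\}$ such that for all $s\in\mathscr{S}_{d(n)+1}(p;n)$ we have $p_k(s;n)=0$ for $k\ge d(n)+1$ and $\frac{p_k(s;n)}{a_k}=\theta_{(p;n)}(s)\frac{p_{d(n)-k}(s;n)}{a_{d(n)-k}}$ for $0\le k\le d(n)$. The polynomials. Put $a(x)=2x(2x-1)$ and $b(x)=2x(2x+1)$. $P_0(x;y)=Q_0(x;y)=1$. For $k\ge1$, $P_k(x;y)$ is the determinant of the $k\times k$ tridiagonal matrix with diagonal entries $(y-4(i-1))x$ in position $(i,i)$ $(1\le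 i\le k)$, entries $a(i)$ in position $(i,i+1)$, and entries $-a\left(\frac{y-2i+2}{2}\right)$ in position $(i+1,i)$ $(1\le i\le k-1)$. For $k\ge1$, $Q_k(x;y)$ is the determinant of the $k\times k$ tridiagonal matrix with diagonal entries $(y-2-4(i-1))x$ in position $(i,i)$ $(1\le i\le k)$, entries $b(i)$ in position $(i,i+1)$, and entries $-b\left(\frac{y-2i}{2}\right)$ in position $(i+1,i)$ $(1\le i\le k-1)$. *)

(* Defs.v *)
From mathcomp Require Import all_boot all_order all_algebra.
From mathcomp Require Import reals complex.

Set Implicit Arguments.
Unset Strict Implicit.
Unset Printing Implicit Defensive.

Import GRing.Theory.

Local Open Scope ring_scope.

(* Two-variable polynomials p(x;y) follow the convention of polyXY: p.[x, y]  *)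
(* substitutes x for the outer variable 'X and y for the inner variable 'Y.   *)
Definition zero_set (R : realType) (p : nat -> {poly {poly R[i]}})
    (k n : nat) : pred R[i] :=
  fun s => (p k).[s, n%:R] == 0.

(* In d n = m%:R, the natural number m is the value d(n) seen as an index, so *)
(* n is unconstrained when d(n) is not a nonnegative integer.                 *)
Definition palindromic_pair (R : realType) (p : nat -> {poly {poly R[i]}})
    (a : nat -> R[i]) (d : nat -> R) : Prop :=
  [/\ p 0%N = 1,
      (forall k : nat, a k != 0)
    & forall n m : nat, d n = m%:R ->
      exists2 theta : {s : R[i] | zero_set p m.+1 n s} -> R[i],
        (forall s, theta s = 1 \/ theta s = -1)
      & forall s : {s : R[i] | zero_set p m.+1 n s},
          (forall k : nat, (m.+1 <= k)%N -> (p k).[val s, n%:R] = 0) /\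
          (forall k : nat, (k <= m)%N ->
             (p k).[val s, n%:R] / a k
             = theta s * ((p (m - k)%N).[val s, n%:R] / a (m - k)%N))].

(* The functions diag, sup, sub are indexed from 1: diag i is the entry in    *)
(* position (i, i), sup i in position (i, i+1) and sub i in position (i+1, i) *)
(* for the usual 1-based numbering of rows and columns.                       *)
Definition tridiag_mx (A : pzRingType) (k : nat) (diag sup sub : nat -> A) :
    'M[A]_k :=
  \matrix_(i < k, j < k)
    if j == i :> nat then diag i.+1
    else if j == i.+1 :> nat then sup i.+1
    else if i == j.+1 :> nat then sub j.+1
    else 0.

Definition afun (A : pzRingType) (x : A) : A := 2%:R * x * (2%:R * x - 1).
Definition bfun (A : pzRingType) (x : A) : A := 2%:R * x * (2%:R * x + 1).

Section Polynomials.
Variable R : realType.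

Local Notation half := ((2%:R^-1 : R[i])%:P%:P).

(* For k = 0 the determinant of the empty matrix is 1, as required. *)
Definition P_ (k : nat) : {poly {poly R[i]}} :=
  \det (tridiag_mx k
    (fun i => ('Y - (4 * (i - 1))%:R) * 'X)
    (fun i => afun i%:R)
    (fun i => - afun (half * ('Y - (2 * i)%:R + 2%:R)))).

Definition Q_ (k : nat) : {poly {poly R[i]}} :=
  \det (tridiag_mx k
    (fun i => ('Y - 2%:R - (4 * (i - 1))%:R) * 'X)
    (fun i => bfun i%:R)
    (fun i => - bfun (half * ('Y - (2 * i)%:R)))).

End Polynomials.

(* Main.v *)
Require Import Defs.
From mathcomp Require Import all_boot all_order all_algebra.
From mathcomp Require Import reals complex.
From mathcomp Require Import ring zify.

(** Expanding the tridiagonal determinants along the last row gives three-term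
    recurrences.  Fix y = n with d(n) = m, and let w be a(x) for the first
    family and b(x) for the second.  Both normalising sequences (2k)! and
    (2k+1)! are the products w(1) ... w(k), and after division by them the
    recurrences of both families take the same form
    [w(k+1) p_(k+1) - w(m-k+1) p_(k-1) = (m - 2k) t p_k],  t = 2x,
    with the convention p_(-1) = 0.  The substitution k -> m - k changes the
    sign of both sides, so the reversed sequence p_(m-k) satisfies the same
    recurrence for 0 < k < m ([normalized_reverse]).  At a zero x of p_(m+1),
    the step k = m of the recurrence becomes the initial step k = 0 for the
    reversed sequence.  A solution is determined by its value at 0, so
    p_(m-k) = p_m p_k for all k <= m; at k = m this says p_m ^ 2 = 1, and the
    sign theta is p_m.  Finally w(0) = 0 cuts the recurrence at k = m + 1, so
    p_(m+1) = 0 forces all later terms to vanish. *)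

Import GRing.Theory Num.Theory.

Local Open Scope ring_scope.

Section TridiagonalDeterminant.
Variables (A : comPzRingType) (diag sup sub : nat -> A).
Let D k := \det (tridiag_mx k diag sup sub).

Lemma det_tridiag0 : D 0%N = 1.
Proof. exact: det_mx00. Qed.

Lemma det_tridiag1 : D 1%N = diag 1%N.
Proof. by rewrite /D det_mx11 mxE. Qed.

(** Only two entries of the last row are nonzero.  The minor of the second one
    has a single nonzero entry in its last column, whence the product of the
    two off-diagonal entries. *)
Lemma det_tridiagSS k :
  D k.+2 = diag k.+2 * D k.+1 - sup k.+1 * sub k.+1 * D k.
Proof.
rewrite /D (expand_det_row _ ord_max) !big_ord_recr /= big1 ?add0r; last first.
  move=> i _; rewrite mxE /=.
  have := ltn_ord i.
  by do ![case: eqP => ? /=]; try lia; rewrite mul0r.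
rewrite addrC; congr (_ + _).
  rewrite mxE /= eqxx; congr (_ * _).
  rewrite /cofactor addnn -signr_odd odd_double mul1r.
  congr (\det _); apply/matrixP => i j; rewrite !mxE /= /bump.
  by rewrite ![(_ <= nat_of_ord _)%N]leqNgt !ltn_ord !add0n.
rewrite mxE /= ltn_eqF // (ltn_eqF (leqnSn _)) eqxx.
rewrite /cofactor /= addSn addnn -signr_odd /= odd_double mulN1r.
rewrite (expand_det_col _ ord_max) big_ord_recr /= big1 ?add0r; last first.
  move=> i _; rewrite !mxE /= /bump.
  have := ltn_ord i.
  by do ![case: leqP => ? /=| case: eqP => ? /=]; try lia; rewrite mul0r.
rewrite /cofactor /= addnn -signr_odd odd_double mul1r.
rewrite mulrN mulrA (mulrC (sub _)).
congr (- (_ * _ * _)).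
  rewrite !mxE /= /bump leqnn ltnn add0n add1n eqxx.
  by rewrite gtn_eqF.
congr (\det _); apply/matrixP => i j; rewrite !mxE /= /bump.
rewrite ![(_ <= nat_of_ord _)%N]leqNgt !ltn_ord !add0n.
by rewrite ![(_ <= nat_of_ord _)%N]leqNgt !ltn_ord (leqW (ltn_ord i)) !add0n.
Qed.

End TridiagonalDeterminant.

(** The unnormalised recurrence of both families at a node of degree m.  Its
    coefficient of [X k] is the product w(k+1) w(m-k): the first factor is
    absorbed by the normalisation, the second is the reflection of the leading
    coefficient w(k+2) of the normalised recurrence. *)
Section PalindromicRecurrence.
Variables (F : fieldType) (w : F -> F) (m : nat) (t : F) (X a : nat -> F).
Hypothesis w0 : w 0 = 0.
Hypothesis a0 : a 0%N = 1.
Hypothesis aS : forall k, a k.+1 = w k.+1%:R * a k.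
Hypothesis a_neq0 : forall k, a k != 0.
Hypothesis X0 : X 0%N = 1.
Hypothesis X1 : X 1%N = m%:R * t.
Hypothesis XSS : forall k, X k.+2 =
  (m%:R - 2%:R * k.+1%:R) * t * X k.+1 + w k.+1%:R * w (m%:R - k%:R) * X k.

Let p k := X k / a k.

Lemma weight_neq0 k : w k.+1%:R != 0.
Proof. by have := a_neq0 k.+1; rewrite aS mulf_eq0 negb_or => /andP[]. Qed.

Lemma normalized0 : p 0%N = 1.
Proof. by rewrite /p X0 a0 divr1. Qed.

Lemma normalized1 : w 1%:R * p 1%N = m%:R * t.
Proof.
by rewrite /p X1 aS a0; field; have := weight_neq0 0.
Qed.

Lemma normalizedSS k : w k.+2%:R * p k.+2 =
  (m%:R - 2%:R * k.+1%:R) * t * p k.+1 + w (m%:R - k%:R) * p k.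
Proof.
rewrite /p XSS !aS.
have := weight_neq0 k; have := weight_neq0 k.+1; have := a_neq0 k.
move: (w k.+1%:R) (w k.+2%:R) (w (m%:R - k%:R)) (m%:R - 2 * k.+1%:R) (a k).
by move=> u v z y b b0 v0 u0; field; rewrite b0 u0 v0.
Qed.

Hypothesis Xm1 : X m.+1 = 0.

Let pm1 : p m.+1 = 0. Proof. by rewrite /p Xm1 mul0r. Qed.

(** Since w 0 = 0, the step to index m + 2 does not involve [X m]; from there on
    two consecutive zeros propagate. *)
Lemma recurrence_vanishes k : (m < k)%N -> X k = 0.
Proof.
move=> /subnKC <-; elim/ltn_ind: (k - _)%N => -[|[|i]] IH.
- by rewrite addn0.
- by rewrite addn1 XSS Xm1 mulr0 add0r subrr w0 mulr0 mul0r.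
- have := IH i (leqnSn _); have := IH i.+1 (leqnn _).
  by rewrite !addnS XSS => -> ->; rewrite !mulr0 addr0.
Qed.

(** Both sides solve the same recurrence in k and agree at k = 0.  The induction
    divides by its leading coefficients, which are nonzero because the
    normalising sequence is. *)
Lemma normalized_reverse k : (k <= m)%N -> p (m - k)%N = p m * p k.
Proof.
have wI j : injective ( *%R (w j.+1%:R)) := mulfI (weight_neq0 j).
elim/ltn_ind: k => -[|[|k]] IH le_km.
- by rewrite subn0 normalized0 mulr1.
- (* The step m of the recurrence has p (m + 1) = 0 on its left-hand side. *)
  apply: (wI 0%N); rewrite [RHS]mulrCA normalized1.
  have := normalizedSS (m - 1).
  have ->: ((m - 1).+1 = m)%N by lia.
  rewrite pm1 mulr0 natrB // subKr => /esym/eqP.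
  by rewrite addrC addr_eq0 => /eqP ->; ring.
(* The step m - k - 1, read from right to left, is the recurrence for the
   reversed sequence at k + 1. *)
apply: (wI k.+1).
have := normalizedSS (m - k.+2).
have ->: (m - k.+2).+2 = (m - k)%N by lia.
have ->: (m - k.+2).+1 = (m - k.+1)%N by lia.
have := IH k (leqnSn _) (ltnW (ltnW le_km)).
have := IH k.+1 (leqnn _) (ltnW le_km).
move=> -> ->; rewrite (natrB _ le_km) (natrB _ (ltnW le_km)) subKr.
rewrite (natrB _ (ltnW (ltnW le_km))) => eq_rev.
rewrite [RHS]mulrCA normalizedSS mulrDr [p m * (w _ * _)]mulrCA.
rewrite [w (m%:R - k%:R) * _]eq_rev; ring.
Qed.

Lemma normalized_sign : p m = 1 \/ p m = -1.
Proof.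
have := normalized_reverse m (leqnn m); rewrite subnn normalized0 -expr2.
by move=> /esym/eqP; rewrite sqrf_eq1 => /orP[]/eqP; [left | right].
Qed.

End PalindromicRecurrence.

(** At a node n of degree m, both families reduce to this situation: the
    evaluated determinants satisfy one recurrence whose weight w generates the
    normalising sequence.  The sign at a zero s is p_m(s; n) / a_m. *)
Lemma palindromic_pair_recurrence (R : realType) (p : nat -> {poly {poly R[i]}})
    (a : nat -> R[i]) (d : nat -> R) (w : R[i] -> R[i]) :
    w 0 = 0 -> a 0%N = 1 -> (forall k, a k.+1 = w k.+1%:R * a k) ->
    (forall k, a k != 0) -> p 0%N = 1 ->
    (forall n m, d n = m%:R -> forall s,
       (p 1%N).[s, n%:R] = m%:R * (2%:R * s) /\
       forall k, (p k.+2).[s, n%:R] =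
         (m%:R - 2%:R * k.+1%:R) * (2%:R * s) * (p k.+1).[s, n%:R]
         + w k.+1%:R * w (m%:R - k%:R) * (p k).[s, n%:R]) ->
  palindromic_pair p a d.
Proof.
move=> w0 a0 aS a_neq0 p0 p_rec; split=> // n m d_n.
pose X s k := (p k).[s, n%:R].
have X0 s : X s 0%N = 1 by rewrite /X p0 !hornerE.
have Xm1 s : zero_set p m.+1 n s -> X s m.+1 = 0 by move/eqP.
exists (fun s => X (val s) m / a m) => [[s /Xm1 Xsm1] | [s /Xm1 Xsm1]] /=;
  have [X1 XSS] := p_rec n m d_n s.
  exact: (@normalized_sign _ w m (2%:R * s) (X s) a).
split=> k le_k; first exact: (@recurrence_vanishes _ w m (2%:R * s) (X s)).
have := @normalized_reverse _ w m (2%:R * s) (X s) a a0 aS a_neq0 (X0 s) X1 XSS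
  Xsm1 (m - k)%N (leq_subr k m).
by rewrite subKn.
Qed.

Section Evaluation.
Variable R : realType.

Lemma half_node n m : n%:R / 2%:R = m%:R :> R -> n = (2 * m)%N.
Proof.
move=> n_m; apply/eqP; rewrite -(eqr_nat R) natrM -n_m; apply/eqP.
by field.
Qed.

Lemma half_shifted_node n m :
  (n%:R - 2%:R) / 2%:R = m%:R :> R -> n = (2 * m + 2)%N.
Proof.
move=> n_m; apply/eqP; rewrite -(eqr_nat R) natrD natrM -n_m; apply/eqP.
by field.
Qed.

Section At.
Variables s y : R[i].
Implicit Type q : {poly {poly R[i]}}.

Lemma horner2_nat k : (k%:R : {poly {poly R[i]}}).[s, y] = k%:R.
Proof. by rewrite -!polyC_natr !hornerC. Qed.

Let horner2E := (hornerD, hornerN, hornerM, hornerX, hornerC, horner2_nat).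

(** The constant 1 is restated as the numeral [1%:R], to which [horner2_nat]
    applies. *)
Lemma horner2_afun q : (afun q).[s, y] = afun q.[s, y].
Proof. by rewrite /afun -[X in _ - X]/(1%:R) !horner2E. Qed.

Lemma horner2_bfun q : (bfun q).[s, y] = bfun q.[s, y].
Proof. by rewrite /bfun -[X in _ + X]/(1%:R) !horner2E. Qed.

Lemma horner2_P1 : (P_ R 1).[s, y] = y * s.
Proof. by rewrite /P_ det_tridiag1 subnn muln0 !horner2E subr0. Qed.

Lemma horner2_Q1 : (Q_ R 1).[s, y] = (y - 2%:R) * s.
Proof. by rewrite /Q_ det_tridiag1 subnn muln0 !horner2E subr0. Qed.

(** The subdiagonal entry -a((y - 2i + 2)/2) at i = k + 1 is -a(y/2 - k), and
    a(y/2 - k) = a(m - k) when y = 2m. *)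
Lemma horner2_PSS k :
  (P_ R k.+2).[s, y] = (y - 4%:R * k.+1%:R) * s * (P_ R k.+1).[s, y]
    + afun k.+1%:R * afun (y / 2%:R - k%:R) * (P_ R k).[s, y].
Proof.
rewrite /P_ det_tridiagSS -!/(P_ R _) !(horner2E, horner2_afun).
rewrite mulrN mulNr opprK subn1 !natrM; congr (_ + _ * afun _ * _).
by rewrite -[k.+1]addn1 natrD; field.
Qed.

(** The subdiagonal entry -b((y - 2i)/2) at i = k + 1 is -b((y-2)/2 - k), and
    b((y-2)/2 - k) = b(m - k) when y = 2m + 2. *)
Lemma horner2_QSS k :
  (Q_ R k.+2).[s, y] =
    (y - 2%:R - 4%:R * k.+1%:R) * s * (Q_ R k.+1).[s, y]
    + bfun k.+1%:R * bfun ((y - 2%:R) / 2%:R - k%:R) * (Q_ R k).[s, y].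
Proof.
rewrite /Q_ det_tridiagSS -!/(Q_ R _) !(horner2E, horner2_bfun).
rewrite mulrN mulNr opprK subn1 !natrM; congr (_ + _ * bfun _ * _).
by rewrite -[k.+1]addn1 natrD; field.
Qed.

End At.

End Evaluation.

Theorem theorem1p22 (R : realType) :
  palindromic_pair (P_ R) (fun k => ((2 * k)`!)%:R) (fun n => n%:R / 2%:R)
  /\ palindromic_pair (Q_ R) (fun k => ((2 * k + 1)`!)%:R)
    (fun n => (n%:R - 2%:R) / 2%:R).
Proof.
(* The weights come from (2k+2)! = a(k+1) (2k)! and (2k+3)! = b(k+1) (2k+1)!. *)
have fact_neq0 k : k`!%:R != 0 :> R[i] by rewrite pnatr_eq0 -lt0n fact_gt0.
split.
  apply: (@palindromic_pair_recurrence _ _ _ _ (@afun R[i])) => //.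
  - by rewrite /afun mulr0 mul0r.
  - move=> k; rewrite mulnS !factS !natrM /afun; ring.
  - exact: det_tridiag0.
  move=> n m /half_node -> s; rewrite horner2_P1 natrM.
  split=> [|k]; first by ring.
  rewrite horner2_PSS [_ / 2%:R]mulrAC mulfV ?pnatr_eq0 // mul1r.
  by congr (_ * _ + _); ring.
apply: (@palindromic_pair_recurrence _ _ _ _ (@bfun R[i])) => //.
- by rewrite /bfun mulr0 mul0r.
- move=> k; rewrite mulnS !addn1 !factS !natrM /bfun; ring.
- exact: det_tridiag0.
move=> n m /half_shifted_node -> s; rewrite horner2_Q1 natrD natrM.
split=> [|k]; first by ring.
rewrite horner2_QSS addrK [_ / 2%:R]mulrAC mulfV ?pnatr_eq0 // mul1r.
by congr (_ * _ + _); ring.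
Qed.
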